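(* Let $a<b$ and let $f:[a,b]\rightarrow\mathbb{R}$ be a twice continuously differentiable mapping in $(a,b)$ with $f''\in L^2[a,b]$. Then for all $x\in[a,\frac{a+b}{2}]$, \[ \left|\frac{f(x)+f(a+b-x)}{2}-\frac{1}{b-a}\int_{a}^{b}f(t)\,dt\right| \leq \frac{(b-a)^{1/2}}{\pi}\left[\frac{(b-a)^2}{48}+\left(x-\frac{3a+b}{4}\right)^2\right]^{1/2}\|f''\|_2. \]
   Context: $\|g\|_2=\left(\int_a^b g(t)^2\,dt\right)^{1/2}$.
   Formalization: The function f is additionally assumed continuous on the closed interval [a,b]; without this the inequality fails at x = a (take f = 0 except f(a) = 1). *)

(* Defs.v *)
From HB Require Import structures.
From mathcomp Require Import all_boot all_order all_algebra.
From mathcomp Require Import all_classical all_reals all_analysis.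
Set Implicit Arguments. Unset Strict Implicit. Unset Printing Implicit Defensive.
Import Order.TTheory GRing.Theory Num.Theory.
Import numFieldNormedType.Exports.
Local Open Scope classical_set_scope.
Local Open Scope ring_scope.

Definition C2_open {R : realType} (a b : R) (f : R -> R) : Prop :=
  (forall x, a < x < b -> derivable f x 1) /\
  (forall x, a < x < b -> derivable (derive1 f) x 1) /\
  (forall x, a < x < b -> {for x, continuous (derive1n 2 f)}).

Definition in_L2 {R : realType} (a b : R) (g : R -> R) : Prop :=
  (@lebesgue_measure R).-integrable `[a, b] (fun t => ((g t) ^+ 2)%:E).

Definition L2norm {R : realType} (a b : R) (g : R -> R) : R :=
  Num.sqrt (Rintegral (@lebesgue_measure R) `[a, b] (fun t => (g t) ^+ 2)).

(* Main.v *)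
Require Import Defs.
From HB Require Import structures.
From mathcomp Require Import all_boot all_order all_algebra.
From mathcomp Require Import all_classical all_reals all_analysis.
From mathcomp Require Import ring lra.
Import Order.TTheory GRing.Theory Num.Theory.
Import numFieldNormedType.Exports.
Local Open Scope classical_set_scope.
Local Open Scope ring_scope.

(** Put [m = (a + b) / 2], [u = x - a], [v = m - x].  Two integrations by parts
    give [int f - (u + v) (f x + f (a + b - x)) = int P f''], where the Peano
    kernel [P] is [(t - a)^2 / 2] on [[a, x]], [(t - m)^2 / 2 + (u^2 - v^2) / 2]
    on [[x, a + b - x]] and [(t - b)^2 / 2] on [[a + b - x, b]].  By
    Cauchy-Schwarz the left-hand side is at most [||P||_2 ||f''||_2], and
    [||P||_2^2] is an explicit polynomial in [u] and [v], so that the constant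
    [1 / pi] only requires [pi^2 <= 10].  As [f'] and [f''] may blow up at [a]
    and [b], this is done on the homothetic intervals of ratio [r < 1] centred
    at [m], and then [r] tends to [1]. *)

(** * The bound on pi, from the Taylor series of cosine *)

Lemma exp_coeff_SS_lt (R : realType) (y : R) n : (0 < n)%N -> 0 < y < 2 ->
  y ^+ n.+2 / n.+2`!%:R < y ^+ n / n`!%:R.
Proof.
move=> n0 /andP[y0 y2]; rewrite 2!exprS 2!factS 2!natrM.
have yn : 0 < y ^+ n / n`!%:R by rewrite divr_gt0 ?exprn_gt0 ?ltr0n ?fact_gt0.
rewrite [ltLHS](_ : _ = (y ^+ n / n`!%:R) * ((y * y) / (n.+2%:R * n.+1%:R))).
  rewrite gtr_pMr// ltr_pdivrMr ?mulr_gt0 ?ltr0n// mul1r.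
  by apply: ltr_pM; rewrite ?ltW// (lt_le_trans y2)// ler_nat.
by field; rewrite nat1r -natrD !pnatr_eq0 -!lt0n fact_gt0 ?addn_gt0.
Qed.

(** After an odd number of terms the rest of the series groups into pairs, each negative because the
    terms decrease in absolute value. *)
Lemma cos_lt_sum_cos_coeff' (R : realType) (y : R) n : odd n -> 0 < y < 2 ->
  cos y < \sum_(0 <= i < n) cos_coeff' y i.
Proof.
move=> n_odd y02; have /cvgN h := @cvg_cos_coeff' R y.
rewrite -ltrN2 -(cvg_lim (@Rhausdorff R) h) -sumrN -seriesN.
apply: lt_sum_lim_series => [|d]; first by move/cvgP in h; rewrite seriesN.
rewrite addnS; have : odd (n + d.*2) by rewrite oddD odd_double addbF.
move: (n + d.*2)%N => {n_odd}n n_odd.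
rewrite /= /cos_coeff' -!exprnP.
rewrite -[(-1) ^+ n.+1]signr_odd -[(-1) ^+ n]signr_odd /= n_odd.
rewrite /= expr0 expr1 mul1r !mulN1r mulNr opprK subr_gt0 doubleS.
by apply: exp_coeff_SS_lt; rewrite // double_gt0; case: n n_odd.
Qed.

Lemma sqr_pi_le10 (R : realType) : (pi : R) ^+ 2 <= 10.
Proof.
rewrite leNgt; apply/negP => pi10.
(* The Taylor bound at [y = sqrt 10 / 2] is negative, so the first zero of
   [cos] lies below [y]. *)
pose y : R := Num.sqrt (5 / 2).
have y2 : y ^+ 2 = 5 / 2 by rewrite sqr_sqrtr; lra.
have y_gt0 : 0 < y by rewrite sqrtr_gt0; lra.
have y_lt2 : y < 2 by nra.
have : 0 < cos y.
  by have pi0 := pi_gt0 R; apply: cos_gt0_pihalf; nra.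
apply/negP; rewrite -leNgt; apply: ltW; apply: lt_le_trans.
  (* Three terms would not do: they give [1 - 5/4 + 25/96 = 1/96 > 0]. *)
  by apply: (@cos_lt_sum_cos_coeff' _ _ 5); rewrite // y_gt0.
have f2 : (2 * 1)`!%:R = 2 :> R by [].
have f4 : 4`!%:R = 24 :> R by [].
have f6 : 6`!%:R = 720 :> R by rewrite 2!factS 2!natrM f4; lra.
have f8 : 8`!%:R = 56 * 720 :> R by rewrite 2!factS 2!natrM f6; lra.
rewrite !big_nat_recr//= big_nil /cos_coeff' -!exprnP -!muln2.
rewrite !(mulnC _ 2%N) !exprM y2 f8 f6 f4 f2 fact0; lra.
Qed.

(* [int P^2] for the kernel [P] of the header. *)
Definition peano_sqr_norm {R : realType} (u v : R) : R :=
  (u ^+ 5 + v ^+ 5) / 10 + (u ^+ 2 - v ^+ 2) * v ^+ 3 / 3 +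
  (u ^+ 2 - v ^+ 2) ^+ 2 * v / 2.

(** As [u + v = (b - a) / 2] and [u - v = 2 * (x - (3 * a + b) / 4)], this is [(b - a) ^+ 3 / 10]
    times the bracket of the theorem. *)
Definition peano_sqr_bound {R : realType} (u v : R) : R :=
  (u + v) ^+ 3 * ((u + v) ^+ 2 + 3 * (u - v) ^+ 2) / 15.

(** Expanded in [u] and [v], the difference has only nonnegative coefficients. *)
Lemma peano_sqr_norm_le (R : realType) (u v : R) : 0 <= u -> 0 <= v ->
  peano_sqr_norm u v <= peano_sqr_bound u v.
Proof.
move=> u0 v0; rewrite -subr_ge0.
rewrite (_ : _ - _ = (5 * u ^+ 5 + u ^+ 4 * v + 8 * (u ^+ 3 * v ^+ 2) +
  28 * (u ^+ 2 * v ^+ 3) + 16 * (u * v ^+ 4)) / 30);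
  last by rewrite /peano_sqr_norm /peano_sqr_bound; field.
by rewrite divr_ge0 // !addr_ge0// !mulr_ge0// ?mulr_ge0 ?exprn_ge0.
Qed.

(** * The estimate on compact subintervals of the open interval *)

Section companion.
Context {R : realType} (a b : R) (F f f1 f2 E : R -> R).
Context (dF : forall t, a < t < b -> is_derive t 1 F (f t)).
Context (df : forall t, a < t < b -> is_derive t 1 f (f1 t)).
Context (df1 : forall t, a < t < b -> is_derive t 1 f1 (f2 t)).
Context (dE : forall t, a < t < b -> is_derive t 1 E (f2 t ^+ 2)).

(* An antiderivative of [(f'' - l q)^2] for the piece
   [q t = (t - p)^2 / 2 + k] of the kernel; its monotonicity for every [l] plays
   the role of Cauchy-Schwarz. *)
Let sqr_gap (p k l t : R) : R :=
  E t + l ^+ 2 * ((t - p) ^+ 5 / 20 + k * (t - p) ^+ 3 / 3 + k ^+ 2 * (t - p))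
  - 2 * l * (((t - p) ^+ 2 / 2 + k) * f1 t - (t - p) * f t + F t).

Lemma sqr_gap_homo p k l : {in `]a, b[ &, {homo sqr_gap p k l : x y / x <= y}}.
Proof.
(* Since [q'' = 1], the function [q f1 - q' f + F] has derivative [q f2]; the factor of [l ^+ 2] is
   an antiderivative of [q^2]. *)
have dH t : a < t < b ->
    is_derive t 1 (sqr_gap p k l) ((f2 t - l * ((t - p) ^+ 2 / 2 + k)) ^+ 2).
  move=> tab.
  have dFt := dF _ tab; have dft := df _ tab.
  have df1t := df1 _ tab; have dEt := dE _ tab.
  rewrite /sqr_gap; apply: is_derive_eq.
  by rewrite /GRing.scale /=; field.
apply: ger0_derive1_le_oo => [t|t|t]; rewrite ?inE /= ?in_itv/= => tab.
- by have [] := dH _ tab.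
- by rewrite derive1E (@derive_val _ _ _ _ _ _ _ (dH _ tab)) sqr_ge0.
- by apply/differentiable_continuous/derivable1_diffP; case: (dH _ tab).
Qed.

(** The three pieces are added. The kernel is continuous and vanishes at both ends, so all [f1]
    terms cancel; its slope jumps by [-(u + v)] at [m - v] and [m + v], which leaves the two values
    of [f]. *)
Lemma peano_quadratic l m u v : 0 <= u -> 0 <= v ->
  a < m - (u + v) -> m + (u + v) < b ->
  2 * l * (F (m + (u + v)) - F (m - (u + v))
    - (u + v) * (f (m - v) + f (m + v)))
  <= E (m + (u + v)) - E (m - (u + v)) + l ^+ 2 * peano_sqr_norm u v.
Proof.
move=> u0 v0 am mb.
have H1 : sqr_gap (m - (u + v)) 0 l (m - (u + v)) <=
    sqr_gap (m - (u + v)) 0 l (m - v).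
  by apply: sqr_gap_homo; rewrite ?in_itv/=; lra.
have H2 : sqr_gap m ((u ^+ 2 - v ^+ 2) / 2) l (m - v) <=
    sqr_gap m ((u ^+ 2 - v ^+ 2) / 2) l (m + v).
  by apply: sqr_gap_homo; rewrite ?in_itv/=; lra.
have H3 : sqr_gap (m + (u + v)) 0 l (m + v) <=
    sqr_gap (m + (u + v)) 0 l (m + (u + v)).
  by apply: sqr_gap_homo; rewrite ?in_itv/=; lra.
move: H1 H2 H3; rewrite /sqr_gap /peano_sqr_norm.
set x0 := E _; set x1 := E _; set x2 := E _; set x3 := E _.
set y0 := f1 _; set y1 := f1 _; set y2 := f1 _; set y3 := f1 _.
set z0 := f _; set z1 := f _; set z2 := f _; set z3 := f _.
set w0 := F _; set w1 := F _; set w2 := F _; set w3 := F _.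
by move=> H1 H2 H3; lra.
Qed.

Lemma companion_sqr_interior m u v : 0 <= u -> 0 <= v -> 0 < u + v ->
  a < m - (u + v) -> m + (u + v) < b ->
  (F (m + (u + v)) - F (m - (u + v)) - (u + v) * (f (m - v) + f (m + v))) ^+ 2
  <= peano_sqr_bound u v * (E (m + (u + v)) - E (m - (u + v))).
Proof.
move=> u0 v0 uv am mb; set J := _ - _ * _; set N := E _ - E _.
set K := peano_sqr_bound u v.
have K0 : 0 < K.
  rewrite divr_gt0// mulr_gt0 ?exprn_gt0//.
  by rewrite ltr_pwDl ?exprn_gt0// mulr_ge0 ?sqr_ge0.
(* [J / K] minimises [N - 2 l J + l^2 K] over [l]; nonnegativity of the minimum is [J^2 <= K N]. *)
have := @peano_quadratic (J / K) m u v u0 v0 am mb; rewrite -/J -/N => JN.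
have {}JN : 2 * (J / K) * J <= N + (J / K) ^+ 2 * K.
  apply: (le_trans JN).
  by rewrite lerD2l ler_wpM2l ?sqr_ge0// peano_sqr_norm_le.
rewrite -ler_pdivrMl// (_ : _ * _ = 2 * (J / K) * J - (J / K) ^+ 2 * K).
  by rewrite lerBlDr.
by field; exact: lt0r_neq0.
Qed.
End companion.

(** * Passage to the closed interval *)

Lemma cvg_affine_at_left (R : realType) (a b m k : R) (g : R -> R) :
  {within `[a, b], continuous g} -> a < m < b -> a <= m + k <= b ->
  g (m + r * k) @[r --> 1^'-] --> g (m + k).
Proof.
move=> /subspace_continuousP gc /andP[am mb] /andP[ak kb].
have lin : m + r * k @[r --> 1^'-] --> m + k.
  rewrite -[X in _ --> m + X]mul1r; apply: cvgD; first exact: cvg_cst.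
  by apply: cvgM; [apply: cvg_at_left_filter; exact: cvg_id|exact: cvg_cst].
apply: (cvg_comp (fun r => m + r * k) g); last first.
  by apply: gc; rewrite /= in_itv/= ak.
(* For [0 < r < 1] the point [m + r * k] lies between [m] and [m + k], so continuity within [[a, b]]
   suffices even at an endpoint. *)
move=> P /lin; rewrite /= !nbhs_simpl /= => hP; near=> r.
have : `[a, b]%classic (m + r * k) -> P (m + r * k) by near: r.
apply; rewrite /= in_itv/=.
have r0 : 0 < r by near: r; apply: nbhs_left_gt.
have r1 : r < 1 by near: r; apply: nbhs_left_lt.
nra.
Unshelve. all: end_near. Qed.

Lemma companion_sqr (R : realType) (m u v : R) (F f f1 f2 E : R -> R) :
  0 <= u -> 0 <= v -> 0 < u + v ->
  let a := m - (u + v) in let b := m + (u + v) in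
  (forall t, a < t < b -> is_derive t 1 F (f t)) ->
  (forall t, a < t < b -> is_derive t 1 f (f1 t)) ->
  (forall t, a < t < b -> is_derive t 1 f1 (f2 t)) ->
  (forall t, a < t < b -> is_derive t 1 E (f2 t ^+ 2)) ->
  {within `[a, b], continuous F} ->
  {within `[a, b], continuous f} ->
  {within `[a, b], continuous E} ->
  (F b - F a - (u + v) * (f (m - v) + f (m + v))) ^+ 2
  <= peano_sqr_bound u v * (E b - E a).
Proof.
move=> u0 v0 uv a b dF df df1 dE cF cf cE.
have amb : a < m < b by rewrite /a /b; lra.
pose l r := (F (m + r * (u + v)) - F (m + r * (- (u + v))) -
  r * (u + v) * (f (m + r * (- v)) + f (m + r * v))) ^+ 2.
(* [peano_sqr_bound] is homogeneous of degree 5. *)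
pose h r := r ^+ 5 * peano_sqr_bound u v *
  (E (m + r * (u + v)) - E (m + r * (- (u + v)))).
have cr : r @[r --> (1 : R)^'-] --> (1 : R).
  by apply: cvg_at_left_filter; exact: cvg_id.
have cl : l r @[r --> 1^'-] -->
    (F b - F a - (1 * (u + v)) * (f (m - v) + f (m + v))) ^+ 2.
  rewrite /l; under eq_fun do rewrite expr2; rewrite expr2.
  have c1 : F (m + r * (u + v)) - F (m + r * - (u + v)) -
     r * (u + v) * (f (m + r * - v) + f (m + r * v)) @[r --> 1^'-] -->
     F b - F a - (1 * (u + v)) * (f (m - v) + f (m + v)).
    apply: cvgB.
      by apply: cvgB; apply: (@cvg_affine_at_left _ a b) => //; rewrite /a /b; lra.
    apply: cvgM; first by apply: cvgM; [exact: cr|exact: cvg_cst].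
    by apply: cvgD; apply: (@cvg_affine_at_left _ a b) => //; rewrite /a /b; lra.
  exact: cvgM.
have ch : h r @[r --> 1^'-] --> 1 ^+ 5 * peano_sqr_bound u v * (E b - E a).
  apply: cvgM; last first.
    by apply: cvgB; apply: (@cvg_affine_at_left _ a b) => //; rewrite /a /b; lra.
  apply: cvgM; last exact: cvg_cst.
  exact: (cvg_comp _ _ cr (@exprn_continuous _ 5 1)).
move: cl ch; rewrite expr1n !mul1r => cl ch.
rewrite -(cvg_lim (@Rhausdorff R) cl) -(cvg_lim (@Rhausdorff R) ch).
apply: ler_lim; [exact: cvgP cl|exact: cvgP ch|].
near=> r.
have r0 : 0 < r by near: r; apply: nbhs_left_gt.
have r1 : r < 1 by near: r; apply: nbhs_left_lt.
have := @companion_sqr_interior R a b F f f1 f2 E dF df df1 dE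
  m (r * u) (r * v).
rewrite /l /h !mulrN -mulrDr.
rewrite (_ : peano_sqr_bound _ _ = r ^+ 5 * peano_sqr_bound u v);
  last by rewrite /peano_sqr_bound; field.
have ruv : r * (u + v) < u + v by rewrite gtr_pMl.
by apply; rewrite ?mulr_gt0 ?mulr_ge0 ?(ltW r0)// /a /b; lra.
Unshelve. all: end_near. Qed.

(** * From antiderivatives to integrals *)

Lemma is_derive_parameterized_integral (R : realType) (a b t : R) (g : R -> R) :
  (@lebesgue_measure R).-integrable `[a, b] (EFin \o g) ->
  a < t < b -> {for t, continuous g} ->
  is_derive t 1
    (fun x => parameterized_integral (@lebesgue_measure R) a x g) (g t).
Proof.
move=> gi /andP[at_ tb] gt.
have [dg <-] := continuous_FTC1_closed tb gi at_ gt.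
by rewrite derive1E; exact: derivableP.
Qed.

Lemma companion_sqr_Rintegral (R : realType) (m u v : R) (f : R -> R) :
  0 <= u -> 0 <= v -> 0 < u + v ->
  let a := m - (u + v) in let b := m + (u + v) in
  {within `[a, b], continuous f} -> C2_open a b f ->
  in_L2 a b (derive1n 2 f) ->
  (Rintegral (@lebesgue_measure R) `[a, b] f
    - (u + v) * (f (m - v) + f (m + v))) ^+ 2
  <= peano_sqr_bound u v *
     Rintegral (@lebesgue_measure R) `[a, b] (fun t => derive1n 2 f t ^+ 2).
Proof.
move=> u0 v0 uv a b cf [df [df1 cf2]] if2.
have ab : a <= b by rewrite /a /b; lra.
have fi : (@lebesgue_measure R).-integrable `[a, b] (EFin \o f).
  by apply: continuous_compact_integrable => //; exact: segment_compact.
(* Integrability of [f] and of the square of [f''] makes these antiderivatives continuous up to [a]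
   and [b]. *)
pose int g x := parameterized_integral (@lebesgue_measure R) a x g.
have int0 g : int g a = 0.
  by rewrite /int /parameterized_integral set_itv1 Rintegral_set1.
have := @companion_sqr R m u v (int f) f (derive1 f) (derive1n 2 f)
  (int (fun t => derive1n 2 f t ^+ 2)) u0 v0 uv.
rewrite /= -/a -/b !int0 !subr0; apply; try assumption.
- move=> t tab; apply: (@is_derive_parameterized_integral _ a b) => //.
  by apply/differentiable_continuous/derivable1_diffP; exact: df.
- by move=> t tab; rewrite derive1E; exact/derivableP/df.
- by move=> t tab; rewrite derive1E; exact/derivableP/df1.
- move=> t tab; apply: (@is_derive_parameterized_integral _ a b _
    (fun t => derive1n 2 f t ^+ 2)) => //.
  apply: (@continuous_comp _ _ _ (derive1n 2 f) (fun y => y ^+ 2)).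
    exact: cf2.
  exact: exprn_continuous.
- exact: parameterized_integral_continuous.
- exact: parameterized_integral_continuous.
Qed.

Theorem theorem2p2 (R : realType) (a b : R) (f : R -> R) :
  a < b ->
  {within `[a, b], continuous f} ->
  C2_open a b f ->
  in_L2 a b (derive1n 2 f) ->
  forall x : R, a <= x <= (a + b) / 2 ->
  `| (f x + f (a + b - x)) / 2
     - (b - a)^-1 * Rintegral (@lebesgue_measure R) `[a, b] f |
  <= Num.sqrt (b - a) / pi
     * Num.sqrt ((b - a) ^+ 2 / 48 + (x - (3 * a + b) / 4) ^+ 2)
     * L2norm a b (derive1n 2 f).
Proof.
move=> ab cf Cf Lf x /andP[ax xm].
pose u := x - a; pose v := (a + b) / 2 - x.
have u0 : 0 <= u by rewrite subr_ge0.
have v0 : 0 <= v by rewrite subr_ge0.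
have uv : 0 < u + v by rewrite /u /v; lra.
have := @companion_sqr_Rintegral R ((a + b) / 2) u v f u0 v0 uv.
rewrite (_ : (a + b) / 2 - (u + v) = a); last by rewrite /u /v; lra.
rewrite (_ : (a + b) / 2 + (u + v) = b); last by rewrite /u /v; lra.
rewrite (_ : (a + b) / 2 - v = x); last by rewrite /v; lra.
rewrite (_ : (a + b) / 2 + v = a + b - x); last by rewrite /v; lra.
move=> /(_ cf Cf Lf).
rewrite /L2norm.
pose I := Rintegral (@lebesgue_measure R) `[a, b] f.
pose N := Rintegral (@lebesgue_measure R) `[a, b]
  (fun t => derive1n 2 f t ^+ 2).
rewrite -/I -/N => JN.
have N0 : 0 <= N by apply: Rintegral_ge0 => t _; exact: sqr_ge0.
have pi0 := pi_gt0 R; have pi10 := sqr_pi_le10 R.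
set S := _ + _ ^+ 2.
have S0 : 0 <= S by rewrite addr_ge0 ?sqr_ge0// divr_ge0// sqr_ge0.
have ba : 0 < b - a by rewrite subr_gt0.
have rhs0 : 0 <= Num.sqrt (b - a) / pi * Num.sqrt S * Num.sqrt N.
  by rewrite !mulr_ge0 ?sqrtr_ge0// invr_ge0 ltW.
rewrite -(ler_pXn2r (_ : 0 < 2)%N) ?nnegrE ?normr_ge0// real_normK ?num_real//.
rewrite !exprMn exprVn !sqr_sqrtr ?(ltW ba)//.
set J := I - _ in JN.
rewrite (_ : _ - _ = - J / (b - a)); last first.
  rewrite /J (_ : u + v = (b - a) / 2); last by rewrite /u /v; lra.
  by field; exact: lt0r_neq0.
rewrite expr_div_n sqrrN ler_pdivrMr ?exprn_gt0//.
(* Only [0 < p] and [p ^+ 2 <= 10] are used of pi from here on. *)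
move: pi {rhs0} pi0 pi10 => p p0 p10.
rewrite (_ : _ * _ = (b - a) ^+ 3 * S * N / p ^+ 2); last first.
  by field; exact: lt0r_neq0.
rewrite ler_pdivlMr ?exprn_gt0//.
have BS : peano_sqr_bound u v = (b - a) ^+ 3 * S / 10.
  by rewrite /peano_sqr_bound /S /u /v; field.
have J10 : J ^+ 2 * 10 <= (b - a) ^+ 3 * S * N.
  by move: JN; rewrite BS; lra.
by apply: le_trans J10; rewrite ler_wpM2l ?sqr_ge0.
Qed.
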